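(* There exists a constant $c$ such that for every $n$ one can construct, deterministically in time $O(n^3)$, an $n$-vertex graph satisfying the extension axioms $\mathrm{EA}_k$ for all $k \le \lfloor \log(\log(n))/c \rfloor$.
   Context: $\log$ is base 2. A graph $G$ satisfies the $k$-extension axioms $\mathrm{EA}_k$ if for every set $S \subseteq V(G)$ of size $k$ and every $T \subseteq S$ there exists a vertex $v \notin S$ that is adjacent to every vertex in $T$ and non-adjacent to every vertex in $S\setminus T$. *)

(* Defs.v *)
From mathcomp Require Import all_boot.
Set Implicit Arguments. Unset Strict Implicit. Unset Printing Implicit Defensive.

Definition simple_graph (n : nat) (adj : rel 'I_n) : Prop :=
  (forall i j, adj i j = adj j i) /\ (forall i, ~~ adj i i).

Definition EA (n : nat) (adj : rel 'I_n) (k : nat) : Prop :=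
  forall S : {set 'I_n}, #|S| = k ->
  forall T : {set 'I_n}, T \subset S ->
  exists v : 'I_n, [/\ v \notin S,
                      (forall u, u \in T -> adj v u) &
                      (forall u, u \in S :\: T -> ~~ adj v u)].

(* Deterministic machine model: a unit-cost random-access machine           *)
(* (Cook--Reckhow style) with unboundedly many natural-number registers and *)
(* memory cells, addition, truncated subtraction, constants, indirect       *)
(* load/store and conditional jumps.  Every executed instruction costs one  *)
(* step.                                                                     *)
Inductive instr : Type :=
| IConst of nat & nat
| IAdd of nat & nat & nat
| ISub of nat & nat & nat
| ILoad of nat & nat
| IStore of nat & nat
| IJz of nat & nat
| IJmp of nat
| IHalt.

Record state : Type := St { pc : nat; reg : nat -> nat; mem : nat -> nat }.

Definition upd (f : nat -> nat) (a v : nat) : nat -> nat :=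
  fun x => if x == a then v else f x.

(* One step; None means the machine has halted (IHalt or pc out of range). *)
Definition step (p : seq instr) (s : state) : option state :=
  let: St c R M := s in
  match nth IHalt p c with
  | IConst r v => Some (St c.+1 (upd R r v) M)
  | IAdd r a b => Some (St c.+1 (upd R r (R a + R b)) M)
  | ISub r a b => Some (St c.+1 (upd R r (R a - R b)) M)
  | ILoad r a => Some (St c.+1 (upd R r (M (R a))) M)
  | IStore a b => Some (St c.+1 R (upd M (R a) (R b)))
  | IJz a l => Some (St (if R a == 0 then l else c.+1) R M)
  | IJmp l => Some (St l R M)
  | IHalt => None
  end.

Fixpoint run (p : seq instr) (t : nat) (s : state) : option state :=
  match step p s with
  | None => Some s
  | Some s' => if t is t'.+1 then run p t' s' else None
  end.

Definition init (n : nat) : state := St 0 (upd (fun _ => 0) 0 n) (fun _ => 0).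

Definition out_graph (n : nat) (s : state) : rel 'I_n :=
  fun i j => mem s (i * n + j) != 0.
Arguments out_graph n s : clear implicits.

(* Main.v *)
Require Import Defs.
From mathcomp Require Import all_boot zify.
Set Implicit Arguments. Unset Strict Implicit. Unset Printing Implicit Defensive.

(** Put L = log n, m = log L, Q = L + 1, and read every vertex as a string of base-Q digits.
    A vertex u stores, in its low digits, a list of m * m tests "digit p is a", each of the
    digits p and a being repeated m ^ 3 times and recovered as the maximum of its copies.
    The tests form an m by m disjunctive normal form, and [arrow u v] says that v satisfies
    the formula of u; u and v are adjacent when exactly one of [arrow u v], [arrow v u] holds.

    Given a set S of k < m vertices, their formulas inspect fewer than m ^ 3 digit positions
    altogether. A vertex v that carries 0 at all these positions still decodes to any
    prescribed formula, while the values [arrow u v] for u in S do not depend on that formula.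
    As distinct vertices differ in some digit, any subset of S is cut out by a formula, so v
    can be given any adjacency pattern on S. All this needs (m + 1) * (2 m ^ 2 + 1) * m ^ 3 <= L,
    and k >= 1 forces m >= c.

    The graph is computed by a program in a small language of loops, which is compiled to the
    random-access machine. *)

(** * A loop language compiled to the machine *)

(** The machine has no multiplication, so a product becomes a loop of additions. Its second factor
    is a register, which makes the number of rounds visible to the cost analysis. *)
Inductive expr : Type :=
| Var of nat
| Cst of nat
| Plus of expr & expr
| Minus of expr & expr
| Times of expr & nat
| Fetch of expr.

Inductive cmd : Type :=
| Asg of nat & expr
| Str of expr & expr
| Seq of cmd & cmd
| When of expr & cmd
| For of nat & nat & cmd.

Definition store := ((nat -> nat) * (nat -> nat))%type.

Fixpoint eval (e : expr) (s : store) : nat :=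
  match e with
  | Var r => s.1 r
  | Cst k => k
  | Plus a b => eval a s + eval b s
  | Minus a b => eval a s - eval b s
  | Times a r => eval a s * s.1 r
  | Fetch a => s.2 (eval a s)
  end.

Definition setr (r v : nat) (s : store) : store := (upd s.1 r v, s.2).

(** After a [For] the counter holds the bound, as it does when the compiled loop exits. *)
Fixpoint exec (c : cmd) (s : store) : store :=
  match c with
  | Asg r e => setr r (eval e s) s
  | Str a e => (s.1, upd s.2 (eval a s) (eval e s))
  | Seq c1 c2 => exec c2 (exec c1 s)
  | When e c => if eval e s == 0 then s else exec c s
  | For i r c =>
      setr i (s.1 r) (iteri (s.1 r) (fun j s' => exec c (setr i j s')) s)
  end.

Fixpoint evars (e : expr) : seq nat :=
  match e with
  | Var r => [:: r]
  | Cst _ => [::]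
  | Plus a b | Minus a b => evars a ++ evars b
  | Times a r => r :: evars a
  | Fetch a => evars a
  end.

Fixpoint cvars (c : cmd) : seq nat :=
  match c with
  | Asg r e => r :: evars e
  | Str a e => evars a ++ evars e
  | Seq c1 c2 => cvars c1 ++ cvars c2
  | When e c => evars e ++ cvars c
  | For i r c => [:: i, r & cvars c]
  end.

Fixpoint writes (c : cmd) : seq nat :=
  match c with
  | Asg r _ => [:: r]
  | Str _ _ => [::]
  | Seq c1 c2 => writes c1 ++ writes c2
  | When _ c => writes c
  | For i _ c => i :: writes c
  end.

(** The compiled loop rereads its counter and its bound in every round, so the body may change
    neither if the number of rounds is to be the one fixed by [exec]. *)
Fixpoint loops_ok (c : cmd) : bool :=
  match c with
  | Asg _ _ | Str _ _ => true
  | Seq c1 c2 => loops_ok c1 && loops_ok c2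
  | When _ c => loops_ok c
  | For i r c => [&& i != r, i \notin writes c, r \notin writes c & loops_ok c]
  end.

(* The registers that bound a loop or a multiplication; they alone determine the running time. *)
Fixpoint ebounds (e : expr) : seq nat :=
  match e with
  | Var _ | Cst _ => [::]
  | Plus a b | Minus a b => ebounds a ++ ebounds b
  | Times a r => r :: ebounds a
  | Fetch a => ebounds a
  end.

Fixpoint bounds (c : cmd) : seq nat :=
  match c with
  | Asg _ e => ebounds e
  | Str a e => ebounds a ++ ebounds e
  | Seq c1 c2 => bounds c1 ++ bounds c2
  | When e c => ebounds e ++ bounds c
  | For _ r c => r :: bounds c
  end.

Fixpoint ecost (e : expr) (R : nat -> nat) : nat :=
  match e with
  | Var _ => 2
  | Cst _ => 1
  | Plus a b | Minus a b => ecost a R + ecost b R + 1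
  | Times a r => ecost a R + R r * 6 + 4
  | Fetch a => ecost a R + 1
  end.

Fixpoint cost (c : cmd) (R : nat -> nat) : nat :=
  match c with
  | Asg _ e => ecost e R + 2
  | Str a e => ecost a R + ecost e R + 1
  | Seq c1 c2 => cost c1 R + cost c2 R
  | When e c => ecost e R + 1 + cost c R
  | For _ r c => R r * (cost c R + 5) + 3
  end.

(** Jump targets are absolute, so the code depends on its start address [o]. The value ends up in
    register [d], and all registers from [d] on are scratch. [Times] accumulates in [d], with the
    factor in [d.+1] and the round counter in [d.+2]. *)
Fixpoint ecomp (o d : nat) (e : expr) : seq instr :=
  match e with
  | Var r => [:: IConst d 0; IAdd d d r]
  | Cst k => [:: IConst d k]
  | Plus a b =>
      let ca := ecomp o d a in
      ca ++ ecomp (o + size ca) d.+1 b ++ [:: IAdd d d d.+1]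
  | Minus a b =>
      let ca := ecomp o d a in
      ca ++ ecomp (o + size ca) d.+1 b ++ [:: ISub d d d.+1]
  | Times a r =>
      let ca := ecomp o d.+1 a in
      let l := o + size ca in
      ca ++ [:: IConst d 0; IConst d.+2 0; ISub d.+3 r d.+2; IJz d.+3 (l + 8);
                IAdd d d d.+1; IConst d.+3 1; IAdd d.+2 d.+2 d.+3; IJmp (l + 2)]
  | Fetch a => ecomp o d a ++ [:: ILoad d d]
  end.

Fixpoint ccomp (d o : nat) (c : cmd) : seq instr :=
  match c with
  | Asg r e => ecomp o d e ++ [:: IConst r 0; IAdd r r d]
  | Str a e =>
      let ca := ecomp o d a in
      ca ++ ecomp (o + size ca) d.+1 e ++ [:: IStore d d.+1]
  | Seq c1 c2 => let k1 := ccomp d o c1 in k1 ++ ccomp d (o + size k1) c2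
  | When e c =>
      let ce := ecomp o d e in
      let l := (o + size ce).+1 in
      let k := ccomp d l c in
      ce ++ IJz d (l + size k) :: k
  | For i r c =>
      let k := ccomp d (o + 3) c in
      [:: IConst i 0; ISub d r i; IJz d (o + size k + 6)] ++ k ++
      [:: IConst d 1; IAdd i i d; IJmp o.+1]
  end.

(** * Executions of the machine and placement of code *)

Fixpoint nsteps (p : seq instr) (t : nat) (s s' : state) : Prop :=
  if t is t'.+1 then exists2 s1, step p s = Some s1 & nsteps p t' s1 s'
  else s = s'.

(** Only an upper bound on the time, because [cost] charges a [When] for its body even if the body
    is skipped. *)
Definition reach p T s s' := exists2 t, t <= T & nsteps p t s s'.

Lemma nsteps_cat p t1 t2 s1 s2 s3 :
  nsteps p t1 s1 s2 -> nsteps p t2 s2 s3 -> nsteps p (t1 + t2) s1 s3.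
Proof.
elim: t1 s1 => [|t1 IH] s1 /=; first by move=> ->.
by case=> s h1 h2 h3; exists s => //; apply: IH.
Qed.

Lemma reach_refl p s : reach p 0 s s.
Proof. by exists 0. Qed.

Lemma reach_trans s2 T1 T2 p s1 s3 :
  reach p T1 s1 s2 -> reach p T2 s2 s3 -> reach p (T1 + T2) s1 s3.
Proof.
case=> t1 l1 h1 [t2 l2 h2]; exists (t1 + t2); first exact: leq_add.
exact: nsteps_cat h2.
Qed.

Lemma reach_step s2 T p s1 s3 :
  step p s1 = Some s2 -> reach p T s2 s3 -> reach p T.+1 s1 s3.
Proof. by move=> h [t l h2]; exists t.+1 => //=; exists s2. Qed.

Lemma reach_weaken T1 T2 p s1 s2 : T1 <= T2 -> reach p T1 s1 s2 -> reach p T2 s1 s2.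
Proof. by move=> l [t l1 h]; exists t => //; apply: leq_trans l1 l. Qed.

(** A halted machine ignores the remaining fuel of [run], so upper bounds on the running time
    suffice. *)
Lemma reach_run p T s s' : reach p T s s' -> step p s' = None -> run p T s = Some s'.
Proof.
move=> [t l h] hn; rewrite -(subnKC l); move: (T - t) => k {l T}.
elim: t s h => [|t IH] s /=; first by move=> ->; case: k => [|k] /=; rewrite hn.
by case=> s1 -> h; apply: IH.
Qed.

Fixpoint code_at (p : seq instr) (o : nat) (k : seq instr) : Prop :=
  if k is i :: k' then nth IHalt p o = i /\ code_at p o.+1 k' else True.

Lemma code_at_cat p o k1 k2 :
  code_at p o (k1 ++ k2) <-> code_at p o k1 /\ code_at p (o + size k1) k2.
Proof.
elim: k1 o => [|i k1 IH] o /=; first by rewrite addn0; split=> // -[].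
by rewrite IH addSnnS; split=> [[? []]|[[]]].
Qed.

Lemma code_at_self a k : code_at (a ++ k) (size a) k.
Proof.
elim: k a => [|i k IH] a //=; rewrite nth_cat ltnn subnn; split=> //.
by have := IH (rcons a i); rewrite size_rcons cat_rcons.
Qed.

(** * Register files that agree below the scratch registers *)

Lemma updE f a v : upd f a v a = v.
Proof. by rewrite /upd eqxx. Qed.

Lemma upd_neq f a v x : x != a -> upd f a v x = f x.
Proof. by rewrite /upd => /negPf ->. Qed.

Lemma upd_lt f a v x : x < a -> upd f a v x = f x.
Proof. by move=> h; rewrite upd_neq // neq_ltn h. Qed.

Definition agree (d : nat) (R R' : nat -> nat) := forall r, r < d -> R r = R' r.

Lemma agree_trans d R1 R2 R3 : agree d R1 R2 -> agree d R2 R3 -> agree d R1 R3.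
Proof. by move=> h1 h2 r l; rewrite h1 // h2. Qed.

Lemma agree_le d d' R R' : d <= d' -> agree d' R R' -> agree d R R'.
Proof. by move=> l h r hr; apply: h; apply: leq_trans l. Qed.

Lemma agree_upd d R r v : d <= r -> agree d (upd R r v) R.
Proof. by move=> l x hx; rewrite upd_lt //; apply: leq_trans l. Qed.

Lemma agree_upd2 d R R' r v : agree d R R' -> agree d (upd R r v) (upd R' r v).
Proof. by move=> h x hx; rewrite /upd; case: eqP => // _; apply: h. Qed.

Lemma eval_agree d e R R' M :
  agree d R R' -> all (gtn d) (evars e) -> eval e (R, M) = eval e (R', M).
Proof.
move=> h; elim: e => //= [r|a IHa b IHb|a IHa b IHb|a IHa r|a IHa].
- by rewrite andbT => hr; apply: h.
- by rewrite all_cat => /andP [/IHa -> /IHb ->].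
- by rewrite all_cat => /andP [/IHa -> /IHb ->].
- by case/andP=> hr /IHa ->; rewrite (h _ hr).
- by move=> /IHa ->.
Qed.

Lemma ecost_ext e R R' : {in ebounds e, R =1 R'} -> ecost e R = ecost e R'.
Proof.
elim: e => //= [a IHa b IHb|a IHa b IHb|a IHa r|a IHa] h.
- by rewrite IHa ?IHb // => x hx; apply: h; rewrite mem_cat hx ?orbT.
- by rewrite IHa ?IHb // => x hx; apply: h; rewrite mem_cat hx ?orbT.
- by rewrite IHa ?(h r) ?mem_head // => x hx; apply: h; rewrite inE hx orbT.
- by rewrite IHa.
Qed.

Lemma cost_ext c R R' : {in bounds c, R =1 R'} -> cost c R = cost c R'.
Proof.
elim: c => //= [r e|a e|c1 IH1 c2 IH2|e c IH|i r c IH] h.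
- by rewrite (ecost_ext h).
- by rewrite (@ecost_ext a R R') ?(@ecost_ext e R R') // => x hx; apply: h; rewrite mem_cat hx ?orbT.
- by rewrite IH1 ?IH2 // => x hx; apply: h; rewrite mem_cat hx ?orbT.
- by rewrite (@ecost_ext e R R') ?IH // => x hx; apply: h; rewrite mem_cat hx ?orbT.
- by rewrite IH ?(h r) ?mem_head // => x hx; apply: h; rewrite inE hx orbT.
Qed.

Lemma ebounds_evars e : {subset ebounds e <= evars e}.
Proof.
elim: e => //= [a IHa b IHb|a IHa b IHb|a IHa r] x.
- by rewrite !mem_cat => /orP [/IHa|/IHb] ->; rewrite ?orbT.
- by rewrite !mem_cat => /orP [/IHa|/IHb] ->; rewrite ?orbT.
- by rewrite !inE => /orP [|/IHa] ->; rewrite ?orbT.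
Qed.

Lemma frame c s r : r \notin writes c -> (exec c s).1 r = s.1 r.
Proof.
elim: c s => [q e|a e|c1 IH1 c2 IH2|e c IH|i q c IH] s //=.
- by rewrite inE => h; rewrite upd_neq.
- by rewrite mem_cat negb_or => /andP [h1 h2]; rewrite IH2 // IH1.
- by move=> h; case: ifP => // _; apply: IH.
- rewrite inE negb_or => /andP [hi hc]; rewrite upd_neq //.
  by elim: (s.1 q) => //= j IHj; rewrite IH //= upd_neq.
Qed.

Lemma frame_iter N i c s r : r != i -> r \notin writes c ->
  (iteri N (fun j s' => exec c (setr i j s')) s).1 r = s.1 r.
Proof. by move=> hi hc; elim: N => //= N IH; rewrite frame //= upd_neq. Qed.

(** * Correctness and running time of compiled code *)

Lemma reach1 p s s' : step p s = Some s' -> reach p 1 s s'.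
Proof. by move=> h; apply: reach_step h (reach_refl _ _). Qed.

(** Induction on the number [N] of rounds left, with [j] rounds done and their sum in [d]. A round
    takes six steps, the final test two. *)
Lemma ecomp_mul_loop p l d r R M j N :
  code_at p l [:: IConst d 0; IConst d.+2 0; ISub d.+3 r d.+2; IJz d.+3 (l + 8);
                IAdd d d d.+1; IConst d.+3 1; IAdd d.+2 d.+2 d.+3; IJmp (l + 2)] ->
  r < d -> R r = j + N -> R d.+2 = j -> R d = R d.+1 * j ->
  exists R', [/\ reach p (N * 6 + 2) (St (l + 2) R M) (St (l + 8) R' M),
                R' d = R d.+1 * (j + N) & agree d R' R].
Proof.
move=> /= [i0 [i1 [i2 [i3 [i4 [i5 [i6 [i7 _]]]]]]]] hr.
elim: N j R => [|N IH] j R hR hj hd.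
- exists (upd R d.+3 0); split.
  + apply: reach_step; first by rewrite /= addn2 i2 hR hj addn0 subnn.
    by apply: reach1; rewrite /= i3 updE eqxx.
  + by rewrite upd_neq ?hd ?addn0 //; lia.
  + by apply: agree_upd; lia.
pose R1 := upd (upd (upd (upd R d.+3 (j + N.+1 - j)) d (R d + R d.+1)) d.+3 1) d.+2 j.+1.
have [|||R' [h1 h2 h3]] := IH j.+1 R1.
- by rewrite /R1 !upd_neq ?hR ?addSnnS //; lia.
- by rewrite /R1 updE.
- have -> : R1 d = R d + R d.+1.
    by rewrite /R1 /upd eqxx !ltn_eqF //; lia.
  have -> : R1 d.+1 = R d.+1 by rewrite /R1 !upd_neq //; lia.
  by rewrite hd mulnS addnC.
exists R'; split.
- rewrite mulSn addnC addnCA.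
  have -> : (6 + (2 + N * 6) = (N * 6 + 2).+4.+2)%N by lia.
  apply: reach_step; first by rewrite /= addn2 i2 hR hj.
  apply: reach_step; first by rewrite /= i3 updE; have -> : (j + N.+1 - j == 0) = false by lia.
  apply: reach_step; first by rewrite /= i4 !(@upd_neq _ d.+3); try lia.
  apply: reach_step; first by rewrite /= i5.
  apply: reach_step; first by rewrite /= i6 updE !(@upd_neq _ _ _ d.+2) ?hj ?addn1 //; lia.
  by apply: reach_step; first by rewrite /= i7.
- by rewrite h2 /R1 !upd_neq ?addSnnS //; lia.
- by apply: agree_trans h3 _ => x hx; rewrite /R1 !upd_neq //; lia.
Qed.

(** The second operand is compiled with scratch from [d.+1] on, so the first one survives in [d]. *)
Lemma ecomp_ok p d e o R M :
  code_at p o (ecomp o d e) -> all (gtn d) (evars e) ->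
  exists R', [/\ reach p (ecost e R) (St o R M) (St (o + size (ecomp o d e)) R' M),
                R' d = eval e (R, M) & agree d R' R].
Proof.
elim: e o d R => /= [r|k|a IHa b IHb|a IHa b IHb|a IHa r|a IHa] o d R.
- case=> i1 [i2 _]; rewrite andbT => hr; exists (upd (upd R d 0) d (R r)); split.
  + apply: reach_step; first by rewrite /= i1.
    apply: reach1; rewrite /= i2 updE upd_lt // !addnS addn0 add0n //.
  + by rewrite updE.
  + by move=> x hx; rewrite !upd_lt.
- case=> i1 _ _; exists (upd R d k); split; last exact: agree_upd.
  + by apply: reach1; rewrite /= i1 addn1.
  + by rewrite updE.
- rewrite !code_at_cat all_cat => -[ha [hb [/= i1 _]]] /andP [va vb].
  have [R1 [s1 e1 a1]] := IHa _ _ R ha va.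
  have vb' : all (gtn d.+1) (evars b).
    by apply: sub_all vb => x /= h; apply: ltnW.
  have [R2 [s2 e2 a2]] := IHb _ _ R1 hb vb'.
  exists (upd R2 d (eval a (R, M) + eval b (R, M))); split.
  + rewrite (@ecost_ext b R R1); last first.
      by move=> x hx; rewrite a1 //; exact: (allP vb) (ebounds_evars hx).
    apply: reach_trans (reach_trans s1 s2) _; apply: reach1.
    by rewrite /= i1 a2 // e1 e2 !size_cat /= !addnA addn1 (eval_agree M a1 vb).
  + by rewrite updE.
  + apply: agree_trans (agree_upd _ _ (leqnn _)) _.
    by apply: agree_trans a1; apply: agree_le a2.
- rewrite !code_at_cat all_cat => -[ha [hb [/= i1 _]]] /andP [va vb].
  have [R1 [s1 e1 a1]] := IHa _ _ R ha va.
  have vb' : all (gtn d.+1) (evars b).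
    by apply: sub_all vb => x /= h; apply: ltnW.
  have [R2 [s2 e2 a2]] := IHb _ _ R1 hb vb'.
  exists (upd R2 d (eval a (R, M) - eval b (R, M))); split.
  + rewrite (@ecost_ext b R R1); last first.
      by move=> x hx; rewrite a1 //; exact: (allP vb) (ebounds_evars hx).
    apply: reach_trans (reach_trans s1 s2) _; apply: reach1.
    by rewrite /= i1 a2 // e1 e2 !size_cat /= !addnA addn1 (eval_agree M a1 vb).
  + by rewrite updE.
  + apply: agree_trans (agree_upd _ _ (leqnn _)) _.
    by apply: agree_trans a1; apply: agree_le a2.
- rewrite code_at_cat => -[ha hl] /andP [hr va].
  have va' : all (gtn d.+1) (evars a).
    by apply: sub_all va => x /= h; apply: ltnW.
  have [R1 [s1 e1 a1]] := IHa _ _ R ha va'.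
  pose l := o + size (ecomp o d.+1 a).
  have [|||R2 [s2 e2 a2]] := @ecomp_mul_loop p l d r (upd (upd R1 d 0) d.+2 0) M 0 (R r) hl hr.
  + by rewrite !upd_neq ?a1 //; lia.
  + by rewrite updE.
  + by rewrite muln0 upd_neq ?updE //; lia.
  exists R2; split.
  + have -> : ecost a R + R r * 6 + 4 = ecost a R + (R r * 6 + 2).+2 by lia.
    apply: (reach_trans s1); case: hl => i1 [i2 _].
    apply: reach_step; first by rewrite /= i1.
    apply: reach_step; first by rewrite /= i2.
    by move: s2; rewrite size_cat addnA -/l (addn2 l).
  + rewrite e2 add0n upd_neq ?upd_neq ?e1 //; lia.
  + apply: agree_trans a2 _ => x hx; rewrite !upd_neq ?a1 //; lia.
- rewrite code_at_cat => -[ha [/= i1 _]] va.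
  have [R1 [s1 e1 a1]] := IHa _ _ R ha va.
  exists (upd R1 d (M (eval a (R, M)))); split.
  + apply: (reach_trans s1).
    by apply: reach1; rewrite /= i1 size_cat e1 addnA addn1.
  + by rewrite updE.
  + exact: agree_trans (agree_upd _ _ (leqnn _)) a1.
Qed.

(** The last clause keeps every bound constant during the command, so that [cost] can be evaluated
    at the registers with which the command starts. *)
Definition wf (d : nat) (c : cmd) :=
  [&& all (gtn d) (cvars c), loops_ok c & all (fun r => r \notin writes c) (bounds c)].

(** A simulation by induction on the command. Machine and source registers are compared only below
    [d], since evaluation leaves debris in the scratch registers. *)
Lemma ccomp_ok p d c o R R0 M :
  code_at p o (ccomp d o c) -> wf d c -> agree d R R0 ->
  let s' := exec c (R0, M) in
  exists2 R', reach p (cost c R0) (St o R M) (St (o + size (ccomp d o c)) R' s'.2)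
            & agree d R' s'.1.
Proof.
elim: c o R R0 M => /= [r e|a e|c1 IH1 c2 IH2|e c IH|i r c IH] o R R0 M.
- rewrite code_at_cat => -[he [/= i1 [i2 _]]] /and3P [/= /andP [hr ve] _ _] hR.
  have [R1 [s1 e1 a1]] := ecomp_ok R M he ve.
  exists (upd (upd R1 r 0) r (R1 d)).
  + rewrite (@ecost_ext e R0 R); last first.
      by move=> x hx; rewrite hR //; exact: (allP ve) (ebounds_evars hx).
    apply: reach_trans s1 _; apply: reach_step; first by rewrite /= i1.
    apply: reach1; rewrite /= i2 updE add0n size_cat /= !addnS addn0.
    by rewrite (@upd_neq _ _ _ d) // neq_ltn hr orbT.
  + move=> x hx; rewrite /upd e1 (eval_agree M hR ve); case: eqP => // _.
    by rewrite a1 // hR.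
- rewrite !code_at_cat => -[ha [hb [/= i1 _]]] /and3P [/=]; rewrite all_cat => /andP [va vb] _ _ hR.
  have [R1 [s1 e1 a1]] := ecomp_ok R M ha va.
  have vb' : all (gtn d.+1) (evars e).
    by apply: sub_all vb => x /= h; apply: ltnW.
  have [R2 [s2 e2 a2]] := ecomp_ok R1 M hb vb'.
  exists R2; last by apply: agree_trans (agree_trans a1 hR); apply: agree_le a2.
  rewrite (@ecost_ext a R0 R) ?(@ecost_ext e R0 R1).
  + apply: reach_trans (reach_trans s1 s2) _; apply: reach1.
    rewrite /= i1 a2 // e1 e2 !size_cat /= !addnA addn1.
    by rewrite -(eval_agree M (agree_trans a1 hR) vb) -(eval_agree M hR va).
  + by move=> x hx; rewrite (agree_trans a1 hR) //; exact: (allP vb) (ebounds_evars hx).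
  + by move=> x hx; rewrite hR //; exact: (allP va) (ebounds_evars hx).
- rewrite code_at_cat => -[h1 h2].
  rewrite /wf /= !all_cat => /and3P [/andP [v1 v2] /andP [l1 l2] /andP [b1 b2]] hR.
  have w1 : wf d c1.
    rewrite /wf v1 l1 /=; apply: sub_all b1 => x; rewrite mem_cat negb_or.
    by case/andP.
  have w2 : wf d c2.
    rewrite /wf v2 l2 /=; apply: sub_all b2 => x; rewrite mem_cat negb_or.
    by case/andP.
  have [R1 s1 a1] := IH1 _ _ _ M h1 w1 hR.
  have [R2 s2 a2] := IH2 _ _ _ (exec c1 (R0, M)).2 h2 w2 a1.
  rewrite -surjective_pairing in s2 a2.
  exists R2 => //; rewrite size_cat addnA; apply: reach_trans s1 _.
  rewrite (@cost_ext c2 R0 (exec c1 (R0, M)).1) // => x hx.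
  by rewrite frame //; have := allP b2 _ hx; rewrite mem_cat negb_or => /andP [].
- rewrite code_at_cat /= => -[he [i1 hc]].
  rewrite /wf /= !all_cat => /and3P [/andP [ve vc] lc /andP [_ bc]] hR.
  have wc : wf d c by rewrite /wf vc lc bc.
  have [R1 [s1 e1 a1]] := ecomp_ok R M he ve.
  rewrite (@ecost_ext e R0 R); last first.
    by move=> x hx; rewrite hR //; exact: (allP ve) (ebounds_evars hx).
  rewrite -(eval_agree M hR ve); case: eqP => hz.
  + exists R1; last exact: agree_trans hR.
    rewrite -addnA; apply: reach_trans s1 _.
    apply: (@reach_weaken 1); first by rewrite leq_addr.
    by apply: reach1; rewrite /= i1 e1 hz size_cat /= !addnA addnS addSn.
  + have [R2 s2 a2] := IH _ _ _ M hc wc (agree_trans a1 hR).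
    exists R2 => //; rewrite -addnA; apply: reach_trans s1 _.
    apply: reach_step; first by rewrite /= i1 e1; move/eqP/negPf: hz => ->.
    by rewrite size_cat /= addnA addnS -addSn.
- case=> i1 [i2 [i3]]; rewrite code_at_cat /= => -[hc [i4 [i5 [i6 _]]]].
  rewrite /wf /= => /and3P [/and3P [hi hr vc] /and4P [nir nic nrc lc] /andP [_ bc]] hR.
  have wc : wf d c.
    rewrite /wf vc lc /=; apply: sub_all bc => x; rewrite inE negb_or.
    by case/andP.
  rewrite -[in code_at _ _ _]addn3 in hc.
  set k := ccomp d (o + 3) c in hc i3 i4 i5 i6 *.
  pose it j := iteri j (fun j s' => exec c (setr i j s')) (R0, M).
  (* Induction on the number [N] of rounds left. Control is at the loop test, just after the counter
     was set, and register [i] holds [j]. *)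
  suff loop N j R1 : j + N = R0 r -> agree d R1 (upd (it j).1 i j) ->
      exists2 R', reach p (N * (cost c R0 + 5) + 2) (St o.+1 R1 (it j).2)
                    (St (o + size k + 6) R' (it (R0 r)).2)
                & agree d R' (upd (it (R0 r)).1 i (R0 r)).
    have [|R' h a] := loop (R0 r) 0 (upd R i 0) erefl; first exact: agree_upd2.
    exists R' => //=.
    have -> : R0 r * (cost c R0 + 5) + 3 = (R0 r * (cost c R0 + 5) + 2).+1 by lia.
    apply: reach_step; first by rewrite /= i1.
    by rewrite (_ : o + _ = o + size k + 6) // size_cat /=; lia.
  elim: N j R1 => [|N IHN] j R1 hj ha.
  all: have hsub : R1 r - R1 i = R0 r - j by
    rewrite (ha _ hr) (ha _ hi) updE upd_neq ?frame_iter // eq_sym.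
  + exists (upd R1 d 0); last first.
      by apply: agree_trans (agree_upd _ _ (leqnn _)) _; rewrite -hj addn0.
    apply: reach_step.
      by rewrite /= i2 hsub -hj addn0 subnn.
    by apply: reach1; rewrite /= i3 updE eqxx -hj addn0.
  + have ha' : agree d (upd R1 d (N.+1)) (upd (it j).1 i j).
      exact: agree_trans (agree_upd _ _ (leqnn _)) ha.
    have [R2 s2 a2] := IH _ _ _ (it j).2 hc wc ha'.
    have e2 : (upd (it j).1 i j, (it j).2) = setr i j (it j) by [].
    rewrite e2 -/(it j.+1) in s2 a2.
    (* Every round costs the same: neither the counter nor a register written by the body bounds
       anything inside it. *)
    have ec : cost c (upd (it j).1 i j) = cost c R0.
      apply: cost_ext => x hx; have := allP bc _ hx; rewrite inE negb_or => /andP [h1 h2].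
      by rewrite upd_neq // frame_iter.
    have [||R3 s3 a3] := IHN j.+1 (upd (upd R2 d 1) i j.+1); first by rewrite addSnnS.
      move=> x hx; rewrite /upd; case: eqP => // _.
      by rewrite (ltn_eqF hx) a2.
    exists R3 => //.
    have -> : N.+1 * (cost c R0 + 5) + 2 = (cost c R0 + (N * (cost c R0 + 5) + 2).+3).+2 by lia.
    apply: reach_step.
      by rewrite /= i2 hsub -hj addKn.
    apply: reach_step; first by rewrite /= i3 updE.
    rewrite -ec; apply: (@reach_trans (St (o + 3 + size k) R2 (it j.+1).2)).
      by rewrite -/k in s2; move: s2; rewrite (addn3 o).
    apply: reach_step; first by rewrite /= addn3 i4.
    apply: reach_step; first by rewrite /= -addn3 addnAC addn3 in i5 *; rewrite /= i5.
    apply: reach_step; first by rewrite /= i6.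
    have -> : upd R2 d 1 i + upd R2 d 1 d = j.+1.
      rewrite updE upd_neq ?addn1 ?(ltn_eqF hi) // a2 //=.
      by rewrite frame //= updE.
    by rewrite ec.
Qed.

Lemma ccomp_exec p d c o R (s : store) :
  code_at p o (ccomp d o c) -> wf d c -> agree d R s.1 ->
  exists2 R', reach p (cost c s.1) (St o R s.2)
                (St (o + size (ccomp d o c)) R' (exec c s).2)
            & agree d R' (exec c s).1.
Proof. by case: s => R0 M; apply: ccomp_ok. Qed.

(** * The graph and its extension property *)

Definition digit (Q p x : nat) : nat := x %/ Q ^ p %% Q.

Fixpoint of_digits (Q : nat) (e : nat -> nat) (M : nat) : nat :=
  if M is M'.+1 then e 0 + Q * of_digits Q (fun i => e i.+1) M' else 0.

Lemma digit0 Q x : digit Q 0 x = x %% Q.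
Proof. by rewrite /digit expn0 divn1. Qed.

Lemma digitS Q p x : digit Q p.+1 x = digit Q p (x %/ Q).
Proof. by rewrite /digit expnS divnMA. Qed.

Lemma digit_lt Q p x : 0 < Q -> digit Q p x < Q.
Proof. exact: ltn_pmod. Qed.

Lemma digit_of_digits Q e M p :
  (forall i, e i < Q) -> digit Q p (of_digits Q e M) = if p < M then e p else 0.
Proof.
elim: M e p => [|M IH] e p he /=; first by rewrite /digit div0n mod0n.
have hQ : 0 < Q by apply: leq_ltn_trans (he 0).
case: p => [|p]; first by rewrite digit0 addnC mulnC modnMDl modn_small.
by rewrite digitS addnC mulnC divnMDl // divn_small // addn0 IH.
Qed.

Lemma of_digits_lt Q e M : (forall i, e i < Q) -> of_digits Q e M < Q ^ M.
Proof.
elim: M e => [|M IH] e he //=; have := IH _ (fun i => he i.+1); have := he 0.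
by rewrite expnS; move: (Q ^ M) (of_digits _ _ _); nia.
Qed.

Lemma digit_inj Q P x y : x < Q ^ P -> y < Q ^ P ->
  (forall p, p < P -> digit Q p x = digit Q p y) -> x = y.
Proof.
elim: P x y => [|P IH] x y; first by rewrite expn0; case: x => //; case: y.
case: Q IH => [|Q] IH; first by rewrite exp0n.
rewrite expnS => hx hy h.
rewrite (divn_eq x Q.+1) (divn_eq y Q.+1); congr (_ * _ + _).
- by apply: IH => [||p hp]; rewrite ?ltn_divLR 1?mulnC // -!digitS h.
- by have := h 0 isT; rewrite !digit0.
Qed.

Lemma fresh_lt N (s : seq nat) : size s < N -> exists2 a, a < N & a \notin s.
Proof.
move=> h; have : ~~ all (mem s) (iota 0 N).
  apply/negP => /allP sub; move: h; rewrite ltnNge => /negP; apply.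
  by rewrite -[N in N <= _](size_iota 0); apply: uniq_leq_size; rewrite ?iota_uniq.
by case/allPn=> a; rewrite mem_iota => /= ? ?; exists a.
Qed.

(** Replacing copies by 0 cannot raise the maximum, so one surviving copy is enough to recover the
    digit. *)
Definition decode (Q B x j : nat) : nat := \max_(b < B) digit Q (j * B + b) x.

(** Test [s] of term [t] has number [t * m + s]; its position is stored at the corresponding even
    index and its required digit at the odd index that follows. *)
Definition dnf (m : nat) (d y : nat -> nat) : bool :=
  has (fun t => all (fun s => y (d (t * m + s).*2) == d (t * m + s).*2.+1) (iota 0 m))
      (iota 0 m).

Definition arrow (Q m u v : nat) : bool :=
  dnf m (decode Q (m ^ 3) u) (fun p => digit Q p v).

Lemma decode_lt Q B x j : 0 < Q -> decode Q B x j < Q.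
Proof.
by move=> hQ; rewrite -(prednK hQ) ltnS; apply/bigmax_leqP => b _; rewrite -ltnS prednK ?digit_lt.
Qed.

Lemma pair_lt m t s : t < m -> s < m -> t * m + s < m * m.
Proof. nia. Qed.

Lemma eq_dnf m d d' y y' :
  (forall i, i < m * m -> d i.*2 = d' i.*2 /\ d i.*2.+1 = d' i.*2.+1) ->
  (forall i, i < m * m -> y (d i.*2) = y' (d i.*2)) -> dnf m d y = dnf m d' y'.
Proof.
move=> hd hy; apply: eq_in_has => t; rewrite mem_iota => /= ht.
apply: eq_in_all => s; rewrite mem_iota => /= hs.
have hi := pair_lt ht hs.
by have [h1 h2] := hd _ hi; rewrite hy // h1 h2.
Qed.

(** * A vertex with a prescribed pattern on a given set *)

Section Extension.

Variables (Q m n : nat) (us : seq nat) (tgt : pred nat).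
Let k := size us.
Let B := m ^ 3.
(** One block more than the formula needs: the last one serves to tell the new vertex from the given
    ones. *)
Let M := (m * m).*2.+1 * B.
Hypotheses (hkm : k < m) (hkQ : k < Q).
(** The first inequality makes every string of [M] digits a vertex. By the second, distinct vertices
    differ among their first [Q] digits, so a separating position is itself a legal digit. *)
Hypotheses (hM : Q ^ M <= n) (hn : n <= Q ^ Q).
Hypotheses (us_uniq : uniq us) (us_lt : all (gtn n) us).

Let Q_gt0 : 0 < Q. Proof. exact: leq_ltn_trans hkQ. Qed.
Let m_gt0 : 0 < m. Proof. exact: leq_ltn_trans hkm. Qed.
Let B_gt0 : 0 < B. Proof. by rewrite expn_gt0 m_gt0. Qed.

Definition inspected := [seq decode Q B u i.*2 | u <- us, i <- iota 0 (m * m)].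

(** The formulas of [us] inspect at most $k m^2 < m^3$ positions, too few to cover a block. *)
Lemma inspected_gap j : exists2 b, b < B & j * B + b \notin inspected.
Proof.
have : ~~ all (mem inspected) (iota (j * B) B).
  apply/negP => /allP sub.
  have : B <= size inspected.
    by rewrite -[B in B <= _](size_iota (j * B)); apply: uniq_leq_size; rewrite ?iota_uniq.
  by rewrite size_allpairs size_iota -/k leqNgt /B expnS -mulnn ltn_pmul2r ?hkm ?muln_gt0 ?m_gt0.
case/allPn=> i; rewrite mem_iota => /andP [h1 h2] h3.
by exists (i - j * B); rewrite ?subnKC //; lia.
Qed.

(** The default 0 keeps the value a legal digit when no separating position exists, as for
    [u = w]. *)
Definition sep (u w : nat) : nat :=
  let p := find (fun p => digit Q p u != digit Q p w) (iota 0 Q) in if p < Q then p else 0.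

Lemma sep_lt u w : sep u w < Q.
Proof. by rewrite /sep; case: ifP. Qed.

Lemma sepP u w : u < n -> w < n -> u != w -> digit Q (sep u w) u != digit Q (sep u w) w.
Proof.
move=> hu hw ne.
have hh : has (fun p => digit Q p u != digit Q p w) (iota 0 Q).
  apply: contraNT ne; rewrite -all_predC => /allP h; apply/eqP.
  apply: (@digit_inj Q Q); [exact: leq_trans hn|exact: leq_trans hn|].
  by move=> p hp; apply/eqP; have := h p; rewrite mem_iota /= negbK; apply.
have := nth_find 0 hh; rewrite has_find size_iota in hh.
by rewrite /sep hh nth_iota.
Qed.

(** The formula of [v] has one term for each [u] in [us] that it should accept. The term tests
    digits of [u] at positions separating [u] from each member, so it holds at [u] and fails at
    every other member. *)
Lemma extension : exists v, [/\ v < n, v \notin us &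
  {in us, forall u, arrow Q m v u (+) arrow Q m u v = tgt u}].
Proof.
have [a0 a0_lt a0_new] : exists2 a, a < Q & a \notin [seq digit Q 0 u | u <- us].
  by apply: fresh_lt; rewrite size_map.
(* The content of the extra block, which forces [v] outside [us]. *)
have [a1 a1_lt a1_new] : exists2 a, a < Q & a \notin [seq decode Q B u (m * m).*2 | u <- us].
  by apply: fresh_lt; rewrite size_map.
(* Since [v] will be 0 wherever [u] looks, [arrow u v] is known in advance; [tgt'] is what the
   formula of [v] has to contribute. *)
pose tgt' u := tgt u (+) dnf m (decode Q B u) (fun _ => 0).
pose good t := (t < k) && tgt' (nth 0 us t).
(* When [i %% m] is at least [k], the default of [nth] compares [u] with itself, which yields a test
   that [u] passes. *)
pose pos i := let u := nth 0 us (i %/ m) in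
  if good (i %/ m) then sep u (nth u us (i %% m)) else 0.
pose d j := if j == (m * m).*2 then a1 else
  if odd j then if good (j./2 %/ m) then digit Q (pos j./2) (nth 0 us (j./2 %/ m)) else a0
  else pos j./2.
have d_lt j : d j < Q.
  rewrite /d; case: ifP => // _; case: ifP => _.
    by case: ifP => // _; apply: digit_lt.
  by rewrite /pos; case: ifP => // _; apply: sep_lt.
pose e i := if i \in inspected then 0 else d (i %/ B).
have e_lt i : e i < Q by rewrite /e; case: ifP.
pose v := of_digits Q e M.
have dec_v j : j <= (m * m).*2 -> decode Q B v j = d j.
  move=> hj; have dig_v b : b < B -> digit Q (j * B + b) v = e (j * B + b).
    move=> hb; rewrite digit_of_digits // ifT // /M.
    by apply: (@leq_trans (j.+1 * B)); rewrite ?leq_mul2r ?ltnS ?hj ?orbT // mulSn addnC ltn_add2r.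
  have jB b : b < B -> (j * B + b) %/ B = j by move=> hb; rewrite divnMDl // divn_small ?addn0.
  apply/eqP; rewrite eqn_leq; apply/andP; split.
    by apply/bigmax_leqP => b _; rewrite dig_v // /e jB //; case: ifP.
  have [b hb hnot] := inspected_gap j.
  apply: leq_trans (leq_bigmax (Ordinal hb)).
  by rewrite dig_v //= /e (negPf hnot) jB.
exists v; split.
- exact: leq_trans (of_digits_lt _ e_lt) hM.
- apply/negP => hv; move: a1_new; have := dec_v _ (leqnn _).
  by rewrite {1}/d eqxx => <-; rewrite (map_f (fun u => decode Q B u _)).
move=> u hu; rewrite /arrow -/B.
(* Every position read here is inspected, and there [v] has digit 0, whether the position lies below
   [M] or not. *)
have -> : dnf m (decode Q B u) (fun p => digit Q p v) = dnf m (decode Q B u) (fun _ => 0).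
  apply: eq_dnf => // i hi; rewrite digit_of_digits // /e.
  have -> : decode Q B u i.*2 \in inspected.
    by apply/allpairsP; exists (u, i); rewrite mem_iota.
  by rewrite if_same.
suff -> : dnf m (decode Q B v) (fun p => digit Q p u) = tgt' u by rewrite addbK.
rewrite (_ : dnf _ _ _ = dnf m d (fun p => digit Q p u)); last first.
  by apply: eq_dnf => i hi; rewrite !dec_v //; lia.
have d_even t s : t < m -> s < m -> d (t * m + s).*2 = pos (t * m + s).
  move=> ht hs; have := pair_lt ht hs => hlt.
  by rewrite /d odd_double doubleK ifF //; lia.
have d_odd t s : t < m -> s < m ->
    d (t * m + s).*2.+1 = if good t then digit Q (pos (t * m + s)) (nth 0 us t) else a0.
  move=> ht hs; have := pair_lt ht hs => hlt.
  have -> : d (t * m + s).*2.+1 = if good ((t * m + s) %/ m) then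
      digit Q (pos (t * m + s)) (nth 0 us ((t * m + s) %/ m)) else a0.
    rewrite /d /= odd_double /= uphalf_double ifF //; lia.
  by rewrite divnMDl // divn_small // addn0.
have posE t s : s < m -> pos (t * m + s) =
    if good t then sep (nth 0 us t) (nth (nth 0 us t) us s) else 0.
  by move=> hs; rewrite /pos divnMDl // modnMDl divn_small // addn0 modn_small.
have hui : index u us < k by rewrite index_mem.
apply/hasP/idP => [[t]|hu'].
- rewrite mem_iota => /= ht /allP h.
  have {}h s : s < m -> digit Q (d (t * m + s).*2) u = d (t * m + s).*2.+1.
    by move=> hs; apply/eqP; apply: h; rewrite mem_iota.
  case gt : (good t); last first.
    have := h 0 m_gt0; rewrite d_even // d_odd // posE // gt => e0.
    by move: a0_new; rewrite -e0 map_f.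
  have /andP [htk htg] := gt.
  have [<-//|ne] := eqVneq (nth 0 us t) u.
  (* The test numbered by the index of [u] uses a position separating the owner of the term from
     [u], hence fails at [u]. *)
  have hs : index u us < m by apply: ltn_trans hkm.
  have := h _ hs; rewrite d_even // d_odd // posE // gt nth_index // => /esym/eqP.
  by rewrite (negPf (sepP _ _ ne)) //; apply: (allP us_lt); rewrite ?mem_nth.
- exists (index u us); first by rewrite mem_iota /= (ltn_trans hui).
  apply/allP => s; rewrite mem_iota => /= hs.
  have ht : index u us < m by apply: ltn_trans hkm.
  by rewrite d_even // d_odd // /good hui nth_index // hu'.
Qed.

End Extension.

(** * The program *)

Lemma iteri_inv T (Inv : nat -> T -> Prop) N f (s : T) :
  Inv 0 s -> (forall j s', j < N -> Inv j s' -> Inv j.+1 (f j s')) -> Inv N (iteri N f s).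
Proof.
move=> h0 hS; suff : forall j, j <= N -> Inv j (iteri j f s) by apply.
by elim=> //= j IH hj; apply: hS => //; apply: IH; apply: ltnW.
Qed.

Definition log_cmd (dst src : nat) : cmd :=
  Seq (Asg dst (Cst 0)) (Seq (Asg 10 (Cst 1))
    (For 9 0 (When (Minus (Cst 1) (Minus (Plus (Var 10) (Var 10)) (Var src)))
      (Seq (Asg 10 (Plus (Var 10) (Var 10))) (Asg dst (Plus (Var dst) (Cst 1))))))).

Lemma log_cmdP dst src s :
  dst \notin [:: 0; 9; 10; src] -> src \notin [:: 9; 10] -> 0 < s.1 src <= s.1 0 ->
  (exec (log_cmd dst src) s).1 dst = trunc_log 2 (s.1 src) /\
  (exec (log_cmd dst src) s).2 = s.2.
Proof.
rewrite !inE !negb_or => /and4P [d0 d9 d10 dsrc] /andP [s9 s10] /andP [hpos hle] /=.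
rewrite [upd _ 10 1 0]upd_neq // [upd _ dst 0 0]upd_neq 1?eq_sym //.
pose Inv j (t : store) := [/\ t.1 src = s.1 src, t.1 10 = 2 ^ t.1 dst, t.1 10 <= s.1 src,
  t.1 dst = j \/ s.1 src < 2 ^ (t.1 dst).+1 & t.2 = s.2].
set F := fun j s' => _; set s1 := setr 10 _ _.
have : Inv (s.1 0) (iteri (s.1 0) F s1).
  apply: iteri_inv.
    rewrite /Inv /s1 /=; have -> : upd (upd s.1 dst 0) 10 1 dst = 0 by rewrite upd_neq ?updE.
    by rewrite updE expn0; split=> //; [rewrite !upd_neq // eq_sym | left].
  move=> j t hj [h1 h2 h3 h4 h5]; rewrite /F /Inv /=.
  rewrite [upd _ _ _ src]upd_neq // [upd _ _ _ 10]upd_neq // h1.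
  case: eqP => hc /=.
    rewrite [upd _ _ _ src]upd_neq // [upd _ _ _ 10]upd_neq // [upd _ _ _ dst]upd_neq //.
    by split=> //; right; rewrite expnS -h2; lia.
  rewrite [upd _ dst _ dst]updE [upd _ dst _ src]upd_neq 1?eq_sym // [upd _ dst _ 10]upd_neq 1?eq_sym //.
  rewrite updE [upd _ 10 _ src]upd_neq // [upd _ 10 _ dst]upd_neq //.
  rewrite ![upd _ 9 _ dst]upd_neq // ![upd _ 9 _ src]upd_neq //.
  have e : 2 ^ (t.1 dst + 1) = t.1 10 + t.1 10 by rewrite addn1 expnS -h2; lia.
  rewrite e; split=> //; first lia.
  case: h4 => [->|h4]; first by left; rewrite addn1.
  by exfalso; move: h4; rewrite addn1 in e; rewrite e; lia.
set s2 := iteri _ _ _ => -[h1 h2 h3 h4 h5] /=; rewrite (upd_neq _ _ d9); split; last by [].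
(* If all [n] rounds had doubled, then $2^n \le n$; so the logarithm was reached. *)
case: h4 => h4; last by symmetry; apply: trunc_log_eq => //; rewrite -h2 h3.
by have := ltn_expl (s.1 0) (isT : 1 < 2); rewrite -h4 -h2; lia.
Qed.

(* Registers: 0 = n, 1 = log n, 2 = m = log log n, 3 = Q = 1 + log n,
   4 = m ^ 2, 5 = m ^ 3, 6 = 2 * m ^ 2; the others are local.
   The memory is a table with rows of width n: the digits of u occupy row n + u,
   its decoding row 2n + u, the values [arrow u v] row 3n + u, and the graph rows 0 to n - 1. *)
Definition divmod_cmd : cmd :=
  Seq (Asg 12 (Cst 0)) (Seq (Asg 13 (Var 11))
    (For 9 0 (When (Minus (Cst 1) (Minus (Var 3) (Var 13)))
      (Seq (Asg 13 (Minus (Var 13) (Var 3))) (Asg 12 (Plus (Var 12) (Cst 1))))))).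

(** Each division by [Q] is a loop of [n] conditional subtractions; the $nQ$ divisions still fit
    into cubic time. *)
Definition digits_cmd : cmd :=
  For 7 0 (Seq (Asg 11 (Var 7)) (Seq (Asg 14 (Times (Plus (Var 0) (Var 7)) 0))
    (For 8 3 (Seq divmod_cmd (Seq (Str (Plus (Var 14) (Var 8)) (Var 13)) (Asg 11 (Var 12))))))).

(** With truncated subtraction, [x + (y - x)] is the maximum. *)
Definition max_cmd : cmd :=
  Seq (Asg 13 (Cst 0))
    (For 9 5 (Asg 13 (Plus (Var 13) (Minus (Fetch (Plus (Var 12) (Var 9))) (Var 13))))).

Definition decode_cmd : cmd :=
  For 7 0 (For 8 6
    (Seq (Asg 12 (Plus (Times (Plus (Var 0) (Var 7)) 0) (Times (Var 8) 5))) (Seq max_cmd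
    (Str (Plus (Times (Plus (Plus (Var 0) (Var 0)) (Var 7)) 0) (Var 8)) (Var 13))))).

(** The sum of the two truncated differences is nonzero exactly when the digits differ. *)
Definition conj_cmd : cmd :=
  Seq (Asg 16 (Cst 1)) (For 10 2
    (Seq (Asg 11 (Plus (Times (Var 9) 2) (Var 10)))
    (Seq (Asg 11 (Plus (Var 12) (Plus (Var 11) (Var 11))))
    (When (Plus (Minus (Fetch (Plus (Var 14) (Fetch (Var 11)))) (Fetch (Plus (Var 11) (Cst 1))))
               (Minus (Fetch (Plus (Var 11) (Cst 1))) (Fetch (Plus (Var 14) (Fetch (Var 11))))))
      (Asg 16 (Cst 0)))))).

Definition dnf_cmd : cmd :=
  Seq (Asg 15 (Cst 0)) (For 9 2 (Seq conj_cmd (When (Var 16) (Asg 15 (Cst 1))))).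

Definition arrow_cmd : cmd :=
  For 7 0 (For 8 0
    (Seq (Asg 12 (Times (Plus (Plus (Var 0) (Var 0)) (Var 7)) 0))
    (Seq (Asg 14 (Times (Plus (Var 0) (Var 8)) 0))
    (Seq dnf_cmd
    (Str (Plus (Times (Plus (Plus (Plus (Var 0) (Var 0)) (Var 0)) (Var 7)) 0) (Var 8)) (Var 15)))))).

(** On bits the absolute difference is exclusive or. It is symmetric and vanishes on the diagonal,
    so the graph is simple. *)
Definition graph_cmd : cmd :=
  For 7 0 (For 8 0
    (Seq (Asg 12 (Fetch (Plus (Times (Plus (Plus (Plus (Var 0) (Var 0)) (Var 0)) (Var 7)) 0) (Var 8))))
    (Seq (Asg 13 (Fetch (Plus (Times (Plus (Plus (Plus (Var 0) (Var 0)) (Var 0)) (Var 8)) 0) (Var 7))))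
    (Str (Plus (Times (Var 7) 0) (Var 8))
         (Plus (Minus (Var 12) (Var 13)) (Minus (Var 13) (Var 12))))))).

(** * Correctness of the subroutines *)

Lemma divmod_cmdP s : s.1 11 <= s.1 0 -> 0 < s.1 3 ->
  [/\ (exec divmod_cmd s).1 12 = s.1 11 %/ s.1 3,
      (exec divmod_cmd s).1 13 = s.1 11 %% s.1 3 & (exec divmod_cmd s).2 = s.2].
Proof.
move=> hy hQ /=; rewrite [upd _ 13 _ 0]/upd /= [upd _ 12 _ 0]/upd /=.
set y := s.1 11 in hy *; set Q := s.1 3 in hQ *.
pose Inv j (t : store) := [/\ t.1 3 = Q, t.1 12 * Q + t.1 13 = y,
  t.1 13 < Q \/ t.1 12 = j & t.2 = s.2].
set F := fun j s' => _; set s1 := setr 13 _ _.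
have : Inv (s.1 0) (iteri (s.1 0) F s1).
  apply: iteri_inv; first by rewrite /Inv /s1 /= /upd /=; split=> //; right.
  move=> j t hj [h1 h2 h3 h4]; rewrite /F /Inv /= /upd /= h1.
  case: eqP => hc; rewrite /= /upd /=; split=> //; first by left; lia.
  - by rewrite addn1 mulSn; move: (_ * Q) h2; lia.
  - by case: h3 => [|->]; [lia|right; rewrite addn1].
case=> h1 h2 h3 h4; rewrite /upd /=.
set s2 := iteri _ _ _ in h1 h2 h3 h4 *.
(* If every round subtracted, the bound [y <= s.1 0] leaves remainder 0. *)
have hr : s2.1 13 < Q by case: h3 => // h3; move: h2; rewrite h3; nia.
by rewrite -h2 divnMDl // divn_small // addn0 modnMDl modn_small.
Qed.

Lemma max_cmdP s :
  (exec max_cmd s).1 13 = \max_(b < s.1 5) s.2 (s.1 12 + b) /\ (exec max_cmd s).2 = s.2.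
Proof.
rewrite /= [upd _ 13 _ 5]/upd /=; set F := fun j s' => _; set s1 := setr 13 _ _.
pose Inv j (t : store) :=
  [/\ t.1 13 = \max_(b < j) s.2 (s.1 12 + b), t.1 12 = s.1 12 & t.2 = s.2].
have : Inv (s.1 5) (iteri (s.1 5) F s1).
  apply: iteri_inv; first by rewrite /Inv /s1 /= /upd /= big_ord0.
  move=> j t hj [h1 h2 h3]; rewrite /F /Inv /= /upd /= h1 h2 h3.
  by rewrite big_ord_recr /= maxnE.
by case=> h1 h2 h3; rewrite /upd /= h1.
Qed.

Lemma iota0S j : iota 0 j.+1 = rcons (iota 0 j) j.
Proof. by rewrite -addn1 iotaD cats1. Qed.

Lemma conj_cmdP s :
  (exec conj_cmd s).1 16 =
    all (fun i => s.2 (s.1 14 + s.2 (s.1 12 + (s.1 9 * s.1 2 + i).*2)) ==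
                  s.2 (s.1 12 + (s.1 9 * s.1 2 + i).*2.+1)) (iota 0 (s.1 2)) :> nat /\
  (exec conj_cmd s).2 = s.2.
Proof.
rewrite /= [upd _ 16 _ 2]/upd /=; set F := fun j s' => _; set s1 := setr 16 _ _.
set P := fun i => _.
pose Inv j (t : store) :=
  [/\ t.1 16 = all P (iota 0 j), forall r, r \in [:: 2; 9; 12; 14] -> t.1 r = s.1 r & t.2 = s.2].
have : Inv (s.1 2) (iteri (s.1 2) F s1).
  apply: iteri_inv.
    rewrite /Inv /s1 /= /upd /=; split=> // r.
    by rewrite !inE => /or4P [] /eqP ->.
  move=> j t hj [h1 h2 h3].
  rewrite /F /Inv iota0S all_rcons /= /upd /= !h2 // h3.
  have -> : s.1 12 + (s.1 9 * s.1 2 + j + (s.1 9 * s.1 2 + j)) =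
            s.1 12 + (s.1 9 * s.1 2 + j).*2 by rewrite addnn.
  rewrite addn1 -addnS addn_eq0 !subn_eq0 -eqn_leq -/(P j).
  case: (P j); rewrite /= /upd /=; split=> //.
  - by move=> r hr; rewrite -(h2 r) //; move: hr; rewrite !inE => /or4P [] /eqP ->.
  - by move=> r hr; rewrite -(h2 r) //; move: hr; rewrite !inE => /or4P [] /eqP ->.
by case=> h1 h2 h3; rewrite /upd /= h1.
Qed.

Lemma dnf_cmdP s :
  (exec dnf_cmd s).1 15 =
    dnf (s.1 2) (fun p => s.2 (s.1 12 + p)) (fun p => s.2 (s.1 14 + p)) :> nat /\
  (exec dnf_cmd s).2 = s.2.
Proof.
rewrite /dnf_cmd; set c := Seq conj_cmd _; rewrite /= [upd _ 15 _ 2]/upd /=.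
set s1 := setr 15 _ _.
rewrite /dnf; set P := fun t => all _ _.
pose Inv j (t : store) :=
  [/\ t.1 15 = has P (iota 0 j), forall r, r \in [:: 2; 12; 14] -> t.1 r = s.1 r & t.2 = s.2].
have : Inv (s.1 2) (iteri (s.1 2) (fun j s' => exec c (setr 9 j s')) s1).
  apply: iteri_inv.
    rewrite /Inv /s1 /= /upd /=; split=> // r.
    by rewrite !inE => /or3P [] /eqP ->.
  move=> j t hj [h1 h2 h3]; rewrite /Inv iota0S has_rcons /c.
  set t1 := setr 9 j t; rewrite -[exec (Seq _ _) t1]/(exec (When (Var 16) (Asg 15 (Cst 1))) (exec conj_cmd t1)).
  have [e1 e2] := conj_cmdP t1.
  have fr r : r \in [:: 2; 12; 14; 15] -> (exec conj_cmd t1).1 r = t.1 r.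
    by rewrite !inE => /or4P [] /eqP ->; rewrite frame.
  set t2 := exec conj_cmd t1 in e1 e2 fr *.
  move: t2 e1 e2 fr => t2 e1 e2 fr.
  have {}e1 : t2.1 16 = P j.
    by rewrite e1 /t1 /= /upd /= !h2 // h3 /P.
  rewrite /= e1; case: (P j) => /=; rewrite /upd /= ?e2; split=> //.
  - by move=> r hr; rewrite -(h2 r) // -fr; move: hr; rewrite !inE => /or3P [] /eqP ->.
  - by rewrite fr.
  - by move=> r hr; rewrite -(h2 r) // -fr; move: hr; rewrite !inE => /or3P [] /eqP ->.
by case=> h1 h2 h3; rewrite /upd /= h1.
Qed.

(** * Tables in memory and the loops that fill them *)

Definition cell (n k a b : nat) : nat := (k * n + a) * n + b.

Lemma cell_inj n k k' a a' b b' : a < n -> a' < n -> b < n -> b' < n ->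
  cell n k a b = cell n k' a' b' -> [/\ k = k', a = a' & b = b'].
Proof.
have dm q q' r r' : r < n -> r' < n -> q * n + r = q' * n + r' -> q = q' /\ r = r'.
  move=> hr hr' e; have n0 : 0 < n by apply: leq_ltn_trans hr.
  have := congr1 (divn^~ n) e; have := congr1 (modn^~ n) e.
  by rewrite !modnMDl !divnMDl // !modn_small // !divn_small // !addn0.
by move=> ha ha' hb hb' /dm [] // /dm [].
Qed.

(** [J] is what one round hands to the next; injectivity of [cl] protects the cells already
    written. *)
Lemma fill_row (cl val : nat -> nat) (J : nat -> store -> Prop) y r c s0 :
  y != r -> y \notin writes c -> r \notin writes c ->
  (forall b b', b < s0.1 r -> b' < s0.1 r -> cl b = cl b' -> b = b') ->
  J 0 s0 ->
  (forall b s, b < s0.1 r -> J b s -> (forall q, q != y -> q \notin writes c -> s.1 q = s0.1 q) ->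
     (forall z, (forall b, b < s0.1 r -> z <> cl b) -> s.2 z = s0.2 z) ->
     (exec c (setr y b s)).2 = upd s.2 (cl b) (val b) /\ J b.+1 (exec c (setr y b s))) ->
  (forall b, b < s0.1 r -> (exec (For y r c) s0).2 (cl b) = val b) /\
  (forall z, (forall b, b < s0.1 r -> z <> cl b) -> (exec (For y r c) s0).2 z = s0.2 z).
Proof.
move=> yr yc rc inj J0 step; rewrite /=.
pose Inv j (t : store) := [/\ J j t, forall q, q != y -> q \notin writes c -> t.1 q = s0.1 q,
  forall b, b < j -> t.2 (cl b) = val b &
  forall z, (forall b, b < j -> z <> cl b) -> t.2 z = s0.2 z].
suff : Inv (s0.1 r) (iteri (s0.1 r) (fun j s' => exec c (setr y j s')) s0) by case.
apply: iteri_inv => [|j t hj [h1 h2 h3 h4]]; first by split.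
have [|e1 e2] := step j t hj h1 h2.
  by move=> z hz; apply: h4 => b hb; apply: hz; apply: ltn_trans hj.
split=> //.
- by move=> q hy hq; rewrite frame //= upd_neq // h2.
- move=> b; rewrite e1 ltnS leq_eqVlt => /predU1P [->|hb]; first by rewrite updE.
  rewrite upd_neq ?h3 //; apply/eqP => /(inj _ _ (ltn_trans hb hj) hj) h.
  by rewrite h ltnn in hb.
- move=> z hz; rewrite e1 upd_neq; last by apply/eqP; apply: hz.
  by apply: h4 => b hb; apply: hz; apply: ltnW.
Qed.

Lemma fill_table n k W val x r c s0 :
  x != r -> x \notin writes c -> r \notin writes c -> s0.1 r = n -> W <= n ->
  (forall a s, a < n -> s.1 x = a -> (forall q, q != x -> q \notin writes c -> s.1 q = s0.1 q) ->
     (forall z, (forall a b, a < n -> b < W -> z <> cell n k a b) -> s.2 z = s0.2 z) ->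
     (forall b, b < W -> (exec c s).2 (cell n k a b) = val a b) /\
     (forall z, (forall b, b < W -> z <> cell n k a b) -> (exec c s).2 z = s.2 z)) ->
  (forall a b, a < n -> b < W -> (exec (For x r c) s0).2 (cell n k a b) = val a b) /\
  (forall z, (forall a b, a < n -> b < W -> z <> cell n k a b) ->
     (exec (For x r c) s0).2 z = s0.2 z).
Proof.
move=> xr xc rc hn hW step; rewrite /= hn.
pose Inv j (t : store) := [/\ forall q, q != x -> q \notin writes c -> t.1 q = s0.1 q,
  forall a b, a < j -> b < W -> t.2 (cell n k a b) = val a b &
  forall z, (forall a b, a < j -> b < W -> z <> cell n k a b) -> t.2 z = s0.2 z].
suff : Inv n (iteri n (fun j s' => exec c (setr x j s')) s0) by case.
apply: iteri_inv => [|j t hj [h1 h2 h3]]; first by split.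
have [|||e1 e2] := step j (setr x j t) hj.
- by rewrite /= updE.
- by move=> q hq; rewrite /= upd_neq //; apply: h1.
- by move=> z hz; apply: h3 => a b ha; apply: hz; apply: ltn_trans hj.
split.
- by move=> q hx hq; rewrite frame //= upd_neq // h1.
- move=> a b; rewrite ltnS leq_eqVlt => /predU1P [->|ha] hb; first exact: e1.
  rewrite e2 /= ?h2 // => b' hb' /cell_inj [] //; try exact: leq_trans hW.
    exact: ltn_trans hj.
  by move=> _ eaj; rewrite eaj ltnn in ha.
- move=> z hz; rewrite e2 => [|b hb]; last exact: hz.
  by apply: h3 => a b ha; apply: hz; apply: ltnW.
Qed.

(** For tables whose cells are computed independently of each other, from memory outside the
    table. *)
Lemma fill_cells n k W val x y r r' c s0 :
  uniq [:: x; y; r] -> [&& x \notin writes c, y \notin writes c & r \notin writes c] ->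
  r' \notin [:: x, y & writes c] ->
  s0.1 r = n -> s0.1 r' = W -> W <= n ->
  (forall a b s, a < n -> b < W -> s.1 x = a -> s.1 y = b ->
     (forall q, q \notin [:: x, y & writes c] -> s.1 q = s0.1 q) ->
     (forall z, (forall a b, a < n -> b < W -> z <> cell n k a b) -> s.2 z = s0.2 z) ->
     (exec c s).2 = upd s.2 (cell n k a b) (val a b)) ->
  let s' := exec (For x r (For y r' c)) s0 in
  (forall a b, a < n -> b < W -> s'.2 (cell n k a b) = val a b) /\
  (forall z, (forall a b, a < n -> b < W -> z <> cell n k a b) -> s'.2 z = s0.2 z).
Proof.
move=> U /and3P [xc yc rc] R' hr hr' hW step s'; rewrite {}/s'.
have /and3P [xy xr yr] : [&& x != y, x != r & y != r].
  by move: U; rewrite /= !inE negb_or -andbA andbT.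
have /and3P [r'x r'y r'c] : [&& r' != x, r' != y & r' \notin writes c].
  by move: R'; rewrite !inE !negb_or.
apply: fill_table => //=; rewrite ?inE ?negb_or ?xy ?[r == y]eq_sym ?yr //.
move=> a s ha sx hs hm.
have er' : s.1 r' = W by rewrite hs // inE negb_or r'y.
have := @fill_row (cell n k a) (val a) (fun _ _ => True) y r' c s; rewrite er' /= er'.
apply=> //; first by rewrite eq_sym.
  by move=> b b' hb hb' /cell_inj [] //; apply: leq_trans hW.
move=> b t hb _ h1 h2; split=> //; rewrite (step a b) //=.
- by rewrite upd_neq // h1.
- by rewrite updE.
- move=> q; rewrite !inE !negb_or => /and3P [q1 q2 q3].
  by rewrite upd_neq // h1 // hs // inE negb_or q2.
- by move=> z hz; rewrite h2 ?hm // => b' hb'; apply: hz.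
Qed.

(** * The tables of digits, decodings and arrows, and the graph *)

Definition digits_at (n Q : nat) (M : nat -> nat) :=
  forall a b, a < n -> b < Q -> M (cell n 1 a b) = digit Q b a.

Definition decode_at (n Q B W : nat) (M : nat -> nat) :=
  forall a j, a < n -> j < W -> M (cell n 2 a j) = decode Q B a j.

Lemma digits_cmdP n Q s : s.1 0 = n -> s.1 3 = Q -> 0 < Q <= n ->
  digits_at n Q (exec digits_cmd s).2.
Proof.
move=> hn hQ /andP [Q0 Qn].
have := @fill_table n 1 Q (fun a b => digit Q b a) 7 0 _ s isT _ _ hn Qn.
rewrite /digits_cmd; set c := Seq (Asg 11 _) _ => /(_ c isT isT) h.
suff step : forall a s1, a < n -> s1.1 7 = a ->
    (forall q, q != 7 -> q \notin writes c -> s1.1 q = s.1 q) ->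
    (forall b, b < Q -> (exec c s1).2 (cell n 1 a b) = digit Q b a) /\
    (forall z, (forall b, b < Q -> z <> cell n 1 a b) -> (exec c s1).2 z = s1.2 z).
  by have [] := h (fun a s1 ha h7 hq _ => step a s1 ha h7 hq).
move=> {h} a s1 ha h7 hq.
have e0 : s1.1 0 = n by rewrite hq.
have e3 : s1.1 3 = Q by rewrite hq.
rewrite /c; set f := For 8 3 _.
pose s2 := setr 14 ((n + a) * n) (setr 11 a s1).
rewrite (_ : exec _ s1 = exec f s2); last by rewrite /= /upd /= e0 h7.
have e3' : s2.1 3 = Q by [].
(* Between rounds register 11 carries the quotient [a %/ Q ^ b], whose lowest digit is stored
   next. *)
have := @fill_row (cell n 1 a) (fun b => digit Q b a) (fun b t => t.1 11 = a %/ Q ^ b) 8 3 _ s2.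
rewrite e3' /f; set c' := Seq divmod_cmd _ => /(_ c' isT isT isT); apply.
- by move=> b b' hb hb' /cell_inj [] //; apply: leq_trans Qn.
- by rewrite expn0 divn1.
move=> b t hb ht ht1 _; set t1 := setr 8 b t.
have [||d1 d2 d3] := @divmod_cmdP t1.
- rewrite /= /upd /= ht ht1 //=; rewrite /upd /= e0.
  by apply: leq_trans (leq_div _ _) (ltnW ha).
- by rewrite /t1 /= /upd /= ht1 // e3'.
have fr r : r \notin writes divmod_cmd -> (exec divmod_cmd t1).1 r = t1.1 r by apply: frame.
rewrite -[exec c' t1]/(exec (Seq (Str (Plus (Var 14) (Var 8)) (Var 13)) (Asg 11 (Var 12)))
                          (exec divmod_cmd t1)).
move: (exec divmod_cmd t1) d1 d2 d3 fr => t2 d1 d2 d3 fr.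
have t14 : t2.1 14 = (n + a) * n by rewrite fr // /t1 /= /upd /= ht1.
have t8 : t2.1 8 = b by rewrite fr.
have t3 : t1.1 3 = Q by rewrite /t1 /= /upd /= ht1 // e3'.
have t11 : t1.1 11 = a %/ Q ^ b by rewrite /t1 /= /upd /= ht.
rewrite /= t14 t8 d2 d3 d1 t3 t11 updE -divnMA -expnSr; split=> //.
by rewrite /cell mul1n.
Qed.

Lemma decode_cmdP n Q B W s :
  s.1 0 = n -> s.1 5 = B -> s.1 6 = W -> W <= n -> W * B <= Q -> Q <= n ->
  digits_at n Q s.2 ->
  digits_at n Q (exec decode_cmd s).2 /\ decode_at n Q B W (exec decode_cmd s).2.
Proof.
move=> hn hB hW Wn WQ Qn hd.
have := @fill_cells n 2 W (fun a j => decode Q B a j) 7 8 0 6 _ s isT _ _ hn hW Wn.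
rewrite /decode_cmd; set c := Seq (Asg 12 _) _ => /(_ c isT isT) [|h1 h2]; last first.
  split=> // a b ha hb; rewrite h2 ?hd // => a' b' ha' hb' /cell_inj [] //.
  - exact: leq_trans Qn.
  - exact: leq_trans Wn.
move=> a j t ha hj t7 t8 hq hm.
have t0 : t.1 0 = n by rewrite hq.
have t5 : t.1 5 = B by rewrite hq.
pose t1 := setr 12 ((n + a) * n + j * B) t.
have [d1 d2] := max_cmdP t1.
have fr r : r \notin writes max_cmd -> (exec max_cmd t1).1 r = t1.1 r by apply: frame.
have {d1} : (exec max_cmd t1).1 13 = decode Q B a j.
  rewrite d1 /= /upd /= t5; apply: eq_bigr => b _.
  have hb : j * B + b < Q.
    apply: leq_trans WQ; apply: (@leq_trans (j.+1 * B)); last by rewrite leq_mul2r hj orbT.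
    by rewrite mulSn addnC ltn_add2r.
  rewrite hm; first by rewrite -addnA -hd // /cell mul1n.
  move=> a' b' ha' hb'; rewrite -addnA -[X in X + a]mul1n => /cell_inj [] //.
  - exact: leq_trans Qn.
  - exact: leq_trans Wn.
have -> : exec c t = exec (Str (Plus (Times (Plus (Plus (Var 0) (Var 0)) (Var 7)) 0) (Var 8))
                               (Var 13)) (exec max_cmd t1).
  by rewrite /t1 -t7 -t8 -t0 -t5.
move: (exec max_cmd t1) d2 fr => t2 d2 fr d1.
rewrite /= d1 d2 !fr //= /upd /= t0 t7 t8 /cell.
by congr upd; rewrite mul2n addnn.
Qed.

Lemma arrow_cmdP n Q m s :
  s.1 0 = n -> s.1 2 = m -> 0 < Q <= n -> (m * m).*2 <= n ->
  digits_at n Q s.2 -> decode_at n Q (m ^ 3) (m * m).*2 s.2 ->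
  forall u v, u < n -> v < n -> (exec arrow_cmd s).2 (cell n 3 u v) = arrow Q m u v.
Proof.
move=> hn hm /andP [Q0 Qn] Wn hd hc.
have := @fill_cells n 3 n (fun u v => arrow Q m u v) 7 8 0 0 _ s isT _ _ hn hn (leqnn n).
rewrite /arrow_cmd; set c := Seq (Asg 12 _) _ => /(_ c isT isT) [|h1 h2 //].
move=> u v t hu hv t7 t8 hq hz.
have t0 : t.1 0 = n by rewrite hq.
have t2 : t.1 2 = m by rewrite hq.
pose t1 := setr 14 ((n + v) * n) (setr 12 ((n + n + u) * n) t).
have [d1 d2] := dnf_cmdP t1.
have fr r : r \notin writes dnf_cmd -> (exec dnf_cmd t1).1 r = t1.1 r by apply: frame.
have md a j : a < n -> j < (m * m).*2 -> t.2 ((n + n + a) * n + j) = decode Q (m ^ 3) a j.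
  move=> ha hj; rewrite addnn -mul2n hz; first exact: hc.
  by move=> a' b' ha' hb' /cell_inj [] //; apply: leq_trans Wn.
have mg a j : a < n -> j < Q -> t.2 ((n + a) * n + j) = digit Q j a.
  move=> ha hj; rewrite -[X in (X + a) * n]mul1n hz; first exact: hd.
  by move=> a' b' ha' hb' /cell_inj [] //; apply: leq_trans Qn.
have {}d1 : (exec dnf_cmd t1).1 15 = arrow Q m u v.
  rewrite d1 /= /upd /= t2 /arrow; congr nat_of_bool; apply: eq_dnf => i hi.
    by rewrite !md //; lia.
  (* A decoded position is itself below [Q], so the lookup stays within the stored digits of [v]. *)
  by rewrite md ?mg ?decode_lt //; lia.
rewrite (_ : exec c t = exec (Str (Plus (Times (Plus (Plus (Plus (Var 0) (Var 0)) (Var 0)) (Var 7)) 0)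
                                   (Var 8)) (Var 15)) (exec dnf_cmd t1)); last first.
  by rewrite /t1 -t7 -t8 -t0.
move: (exec dnf_cmd t1) d1 d2 fr => t3 d1 d2 fr.
rewrite /= d1 d2 !fr //= /upd /= t0 t7 t8 /cell.
by congr upd; rewrite addnn -mul2n -mulSnr.
Qed.

Lemma graph_cmdP n s : s.1 0 = n ->
  forall u v, u < n -> v < n -> (exec graph_cmd s).2 (u * n + v) =
    let A i j := s.2 (cell n 3 i j) in (A u v - A v u) + (A v u - A u v).
Proof.
move=> hn.
have := @fill_cells n 0 n (fun u v => let A i j := s.2 (cell n 3 i j) in
  (A u v - A v u) + (A v u - A u v)) 7 8 0 0 _ s isT _ _ hn hn (leqnn n).
rewrite /graph_cmd; set c := Seq (Asg 12 _) _ => /(_ c isT isT) [|h1 h2 u v hu hv].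
  move=> u v t hu hv t7 t8 hq hz.
  have t0 : t.1 0 = n by rewrite hq.
  rewrite /= /upd /= t0 t7 t8.
  have e3 : n + n + n = 3 * n by lia.
  rewrite e3 -!/(cell n 3 _ _) !hz //; last first.
  - by move=> a b ha hb /cell_inj [].
  - by move=> a b ha hb /cell_inj [].
by rewrite -h1.
Qed.

(** * Parameters and running time *)

Definition logs_cmd : cmd :=
  Seq (log_cmd 1 0) (Seq (log_cmd 2 1) (Asg 3 (Plus (Var 1) (Cst 1)))).

Definition powers_cmd : cmd :=
  Seq (Asg 4 (Times (Var 2) 2)) (Seq (Asg 5 (Times (Var 4) 2)) (Asg 6 (Plus (Var 4) (Var 4)))).

Definition main_cmd : cmd := Seq digits_cmd (Seq decode_cmd (Seq arrow_cmd graph_cmd)).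


(** One evaluation of a formula costs of order $m^3$, which must be $O(n)$ where $n \ge 2^{2^m}$.
    For large [m], $m^3 \le 2^{3m}$ and $3m \le 2^m$. *)
Lemma cube_le_exp m : m ^ 3 <= 4 * 2 ^ (2 ^ m).
Proof.
have [|h] := leqP m 3; first by case: m => [|[|[|[|]]]].
have h3 : 3 * m <= 2 ^ m.
  rewrite -(subnK h); elim: (m - 4) => // j IH.
  by rewrite addSn expnS; lia.
apply: (@leq_trans (2 ^ (m * 3))); first by rewrite expnM leq_exp2r // ltnW // ltn_expl.
by apply: leq_trans (leq_pmull _ _); rewrite ?leq_exp2l // mulnC.
Qed.

Lemma double_square_le_exp m : (m * m).*2 <= 2 ^ (2 ^ m).
Proof.
have [|h] := leqP m 2; first by case: m => [|[|[|]]].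
have h2 : m + m + 1 <= 2 ^ m.
  rewrite -(subnK h); elim: (m - 3) => // j IH.
  by rewrite addSn expnS; lia.
apply: (@leq_trans (2 ^ (m + m + 1))); last by rewrite leq_exp2l.
by rewrite !expnD expn1 muln2 leq_double leq_mul // ltnW // ltn_expl.
Qed.

(** The left side is at most $(2(m+1))^6$. With $q = \lfloor m/12 \rfloor$, $2(m+1) \le 24(q+1) \le
    (q+1)^2 \le 2^{2q}$, and the sixth power is at most $2^m$. The threshold [300 = 12 * 25] ensures
    $24 \le q+1$. *)
Lemma poly_le_exp m : 300 <= m -> m.+1 * ((m * m).*2.+1 * m ^ 3) <= 2 ^ m.
Proof.
move=> hm; pose q := m %/ 12.
have hq : 25 <= q by rewrite leq_divRL //; apply: leq_trans hm.
have hqm : m.+1 <= 12 * q.+1 by rewrite mulnC; apply: ltn_ceil.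
apply: (@leq_trans ((2 * m.+1) ^ 6)).
  rewrite expnMn -[m.+1 ^ 6]/(m.+1 ^ (1 + (2 + 3))) !expnD expn1 [2 ^ 6 * _]mulnCA leq_mul2l /=.
  rewrite mulnA leq_mul ?leq_exp2r //.
  by rewrite -[2 ^ 6]/64 -mulnn (mulSn m) (mulnS m); move: (m * m) => mm; lia.
apply: (@leq_trans (((2 ^ q) ^ 2) ^ 6)).
  rewrite leq_exp2r //; apply: (@leq_trans (q.+1 ^ 2)); last by rewrite leq_exp2r // ltn_expl.
  by have : 24 * q.+1 <= q.+1 * q.+1; [rewrite leq_mul2r; lia | rewrite mulnn; lia].
by rewrite -!expnM leq_exp2l // leq_divM.
Qed.

Lemma cost_logs R : 0 < R 0 -> cost logs_cmd R <= 110 * R 0.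
Proof. by rewrite /=; lia. Qed.

Lemma cost_powers R : R 2 <= R 0 -> 0 < R 0 -> cost powers_cmd R <= 50 * R 0.
Proof. by rewrite /=; lia. Qed.

(** Each nonlinear monomial of the cost is first bounded by a multiple of $n^3$ or $n^2$; what
    remains is linear in these products. *)
Lemma cost_main R (n := R 0) (m := R 2) :
  0 < n -> R 3 <= n -> R 5 = m ^ 3 -> R 6 = (m * m).*2 -> (m * m).*2 <= n -> m ^ 3 <= 4 * n ->
  cost main_cmd R <= 1500 * n ^ 3.
Proof.
move=> n0 hQ h5 h6 hW hc; rewrite /= h5 h6 -/n -/m.
move: (R 3) hQ => Q hQ.
have -> : n ^ 3 = n * n * n by rewrite 2!expnSr expn1.
have m3 : m ^ 3 = m * m * m by rewrite 2!expnSr expn1.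
clear h5 h6; clearbody n m.
rewrite -mul2n m3 in hW hc *.
have hm : m <= n by nia.
have b1 : n * n <= n * n * n by rewrite leq_pmulr.
have b2 : n * n * Q <= n * n * n by rewrite leq_mul2l hQ orbT.
have b3 : n * Q <= n * n by rewrite leq_mul2l hQ orbT.
have b4 : n * n * (2 * (m * m)) <= n * n * n by rewrite leq_mul2l hW orbT.
have b5 : n * (2 * (m * m)) <= n * n by rewrite leq_mul2l hW orbT.
have b6 : n * n * m <= n * n * n by rewrite leq_mul2l hm orbT.
have b7 : n * n * (m * m * m) <= n * n * (4 * n) by rewrite leq_mul2l hc orbT.
have b8 : n * (2 * (m * m) * (m * m * m)) <= n * (n * (4 * n)).
  by rewrite leq_mul2l leq_mul ?orbT.
have b9 : n <= n * n by rewrite leq_pmulr.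
lia.
Qed.

(** Three separate commands, because the later ones use bounds that the earlier ones compute, which
    [wf] forbids within one command. Each is costed at its own starting registers. *)
Definition compile3 (d : nat) (c1 c2 c3 : cmd) : seq instr :=
  let k1 := ccomp d 0 c1 in
  let k2 := ccomp d (size k1) c2 in
  k1 ++ k2 ++ ccomp d (size k1 + size k2) c3.

Lemma compile3_run d c1 c2 c3 n :
  wf d c1 -> wf d c2 -> wf d c3 ->
  let s0 := (upd (fun _ => 0) 0 n, fun _ => 0) in
  let s1 := exec c1 s0 in
  let s2 := exec c2 s1 in
  let p := compile3 d c1 c2 c3 in
  exists R, forall T, cost c1 s0.1 + cost c2 s1.1 + cost c3 s2.1 <= T ->
    run p T (init n) = Some (St (size p) R (exec c3 s2).2).
Proof.
move=> w1 w2 w3 s0 s1 s2 p; have := code_at_self [::] p.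
rewrite cat0s {2}/p /compile3 !code_at_cat add0n => -[k1 [k2 k3]].
have [R1 r1 a1] := ccomp_exec (s := s0) k1 w1 (fun r _ => erefl (s0.1 r)).
have [R2 r2 a2] := ccomp_exec k2 w2 a1.
have [R3 r3 _] := ccomp_exec k3 w3 a2.
(* Control ends just past the last instruction, where the default [IHalt] stops the machine. *)
exists R3 => T hT; apply: reach_run; last by rewrite /= nth_default.
apply: reach_weaken hT _.
have -> : size p = size (ccomp d 0 c1) + size (ccomp d (size (ccomp d 0 c1)) c2) +
    size (ccomp d (size (ccomp d 0 c1) + size (ccomp d (size (ccomp d 0 c1)) c2)) c3).
  by rewrite /p /compile3 !size_cat addnA.
exact: reach_trans (reach_trans r1 r2) r3.
Qed.

(** * The whole program and the final argument *)

Definition program := compile3 20 logs_cmd powers_cmd main_cmd.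

Lemma paramsP n : 2 <= n ->
  let s1 := exec logs_cmd (upd (fun _ => 0) 0 n, fun _ => 0) in
  let s2 := exec powers_cmd s1 in
  let l := trunc_log 2 n in let m := trunc_log 2 l in
  [/\ s1.1 0 = n, s1.1 2 = m, s2.1 0 = n & s2.1 2 = m] /\
  [/\ s2.1 3 = l.+1, s2.1 5 = m ^ 3 & s2.1 6 = (m * m).*2].
Proof.
move=> hn; set s0 : store := (_, _).
have l1 : 0 < trunc_log 2 n by rewrite trunc_log_gt0.
have ln : trunc_log 2 n <= n.
  by apply: leq_trans (ltnW (ltn_expl _ (isT : 1 < 2))) (trunc_logP _ _) => //; apply: ltnW.
have [|e1 _] := @log_cmdP 1 0 s0 isT isT; first by rewrite /= leqnn andbT ltnW.
set t := exec (log_cmd 1 0) s0 in e1.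
have t0 : t.1 0 = n by rewrite /t frame.
have [|e2 _] := @log_cmdP 2 1 t isT isT; first by rewrite t0 e1 l1.
pose t' := exec (log_cmd 2 1) t.
have t'0 : t'.1 0 = n by rewrite /t' frame.
have t'1 : t'.1 1 = trunc_log 2 n by rewrite /t' frame.
rewrite e1 -/t' in e2; rewrite [exec logs_cmd _]/(exec (Asg 3 (Plus (Var 1) (Cst 1))) t').
move: t' t'0 t'1 e2 => t' t'0 t'1 e2 /=.
rewrite /upd /= t'0 t'1 e2 addn1; split=> //; split=> //; last by rewrite addnn.
by rewrite expnS -mulnn mulnA.
Qed.

Theorem mainTheorem3 :
  exists c : nat, 0 < c /\
  exists (p : seq instr) (C : nat),
    forall n : nat, 2 <= n ->
    exists s : state,
      [/\ run p (C * n ^ 3) (init n) = Some s,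
          simple_graph (out_graph n s) &
          forall k : nat, k <= trunc_log 2 (trunc_log 2 n) %/ c ->
            EA (out_graph n s) k].
Proof.
(* 300 is the threshold of [poly_le_exp], and 1660 = 110 + 50 + 1500 adds up the three cost
   bounds. *)
exists 300; split=> //; exists program, 1660 => n hn.
have [R hR] := @compile3_run 20 logs_cmd powers_cmd main_cmd n isT isT isT; have [] := paramsP hn.
move: hR; set s1 := exec logs_cmd _; set s2 := exec powers_cmd s1.
set l := trunc_log 2 n; set m := trunc_log 2 l.
move=> hR [s10 s12 s20 s22] [s23 s25 s26].
have n_gt0 : 0 < n by apply: ltnW.
have l1 : 0 < l by rewrite trunc_log_gt0.
have ln : 2 ^ l <= n by apply: trunc_logP.
have nl : n < 2 ^ l.+1 by apply: trunc_log_ltn.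
have ml : 2 ^ m <= l by apply: trunc_logP.
have lm : l < 2 ^ m.+1 by apply: trunc_log_ltn.
have lln : l < n by apply: leq_trans (ltn_expl _ _) ln.
have mn : m <= n by apply: leq_trans (ltnW lln); apply: leq_trans ml; apply/ltnW/ltn_expl.
have nm : 2 ^ (2 ^ m) <= n by apply: leq_trans ln; rewrite leq_exp2l.
have m3n : m ^ 3 <= 4 * n by apply: leq_trans (cube_le_exp m) _; rewrite leq_mul2l nm orbT.
have mmn : (m * m).*2 <= n by apply: leq_trans (double_square_le_exp m) nm.
set M := (exec main_cmd s2).2 in hR.
exists (St (size program) R M); rewrite hR; last first.
  have c1 := @cost_logs (upd (fun _ => 0) 0 n) n_gt0.
  have c2 : cost powers_cmd s1.1 <= 50 * n by rewrite -[n in _ * n]s10 cost_powers ?s10 ?s12.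
  have c3 : cost main_cmd s2.1 <= 1500 * n ^ 3.
    by rewrite -[n in _ * n ^ _]s20 cost_main ?s20 ?s22 ?s23 ?s25 ?s26.
  have n3 : n <= n ^ 3 by rewrite -[n in n <= _]expn1 leq_pexp2l.
  apply: (@leq_trans (110 * n + 50 * n + 1500 * n ^ 3)).
    exact: leq_add (leq_add c1 c2) c3.
  by move: (n ^ 3) n3 => n3; lia.
pose s3 := exec arrow_cmd (exec decode_cmd (exec digits_cmd s2)).
pose A u v := s3.2 (cell n 3 u v).
have s30 : s3.1 0 = n by rewrite /s3 !frame.
have ME u v : u < n -> v < n -> M (u * n + v) = (A u v - A v u) + (A v u - A u v).
  exact: (graph_cmdP s30).
split=> //.
  split=> [u v|u]; rewrite /out_graph /=; first by rewrite !ME // addnC.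
  by rewrite ME // subnn.
(* For [k = 0] any vertex will do, whereas [m] may be small; a positive [k] forces [m] to be at
   least 300. *)
case=> [|k] hk S cS T sTS.
  exists (Ordinal n_gt0); move: sTS; rewrite (cards0_eq cS) subset0 => /eqP ->.
  by split=> [|u|u]; rewrite !inE.
have hm : 300 <= m by move: (leq_ltn_trans (leq0n _) hk); rewrite divn_gt0.
have km : k.+1 < m by apply: (leq_ltn_trans hk); rewrite ltn_Pdiv //; apply: leq_trans hm.
have pm := poly_le_exp hm.
have ml' : m <= l by apply: leq_trans ml; apply/ltnW/ltn_expl.
have AE u v : u < n -> v < n -> A u v = arrow l.+1 m u v.
  have hd : digits_at n l.+1 (exec digits_cmd s2).2 by apply: digits_cmdP => //; rewrite lln.
  have hW : (m * m).*2 * m ^ 3 <= l.+1.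
    by apply: leqW; apply: leq_trans ml; apply: leq_trans pm; nia.
  have fr r : r \notin writes digits_cmd -> (exec digits_cmd s2).1 r = s2.1 r by apply: frame.
  have [|||||d1 d2] := @decode_cmdP n l.+1 (m ^ 3) (m * m).*2 (exec digits_cmd s2) _ _ _ mmn hW.
  all: rewrite ?fr //.
  have e0 : (exec decode_cmd (exec digits_cmd s2)).1 0 = n by rewrite 2?frame.
  have e2 : (exec decode_cmd (exec digits_cmd s2)).1 2 = m by rewrite 2?frame.
  by move=> hu hv; rewrite /A /s3 (arrow_cmdP e0 e2 _ mmn d1 d2).
pose us := [seq val i | i <- enum S].
have [||||||v [hv vus hadj]] := @extension l.+1 m n us (fun u => u \in [seq val i | i <- enum T]).
- by rewrite size_map -cardE cS.
- by rewrite size_map -cardE cS ltnS; apply: ltnW; apply: leq_trans ml'.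
(* As $Q \le 2^{m+1}$, [poly_le_exp] gives $Q^M \le 2^{(m+1)M} \le 2^{2^m} \le n$. *)
- apply: leq_trans nm; apply: leq_trans (_ : (2 ^ m.+1) ^ ((m * m).*2.+1 * m ^ 3) <= _).
    by rewrite leq_exp2r // muln_gt0 expn_gt0 /=; lia.
  by rewrite -expnM leq_exp2l.
(* Here $n < 2^{l+1} \le Q^Q$, because $Q = l + 1 \ge 2$. *)
- by apply: ltnW; apply: leq_trans nl _; rewrite leq_exp2r.
- by rewrite map_inj_uniq ?enum_uniq //; apply: val_inj.
- by apply/allP => _ /mapP [i _ ->] /=.
have adj (u : 'I_n) : u \in S -> out_graph n (St (size program) R M) (Ordinal hv) u = (u \in T).
  move=> uS; have uus : val u \in us by rewrite map_f // mem_enum.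
  have := hadj _ uus; rewrite /out_graph /= ME // !AE // (mem_map val_inj) mem_enum => <-.
  by do 2 case: arrow.
exists (Ordinal hv); split.
- by apply: contra vus => vS; apply/mapP; exists (Ordinal hv); rewrite ?mem_enum.
- by move=> u uT; rewrite adj // (subsetP sTS).
- by move=> u; rewrite inE => /andP [uT uS]; rewrite adj.
Qed.
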